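(* Let $(G,s,t)$ be a minimal weak link of weight $w$, and let $p$ be the number of its centre vertices. Then every border vertex $b$ (a non-terminal vertex adjacent to $s$ or to $t$) has degree $d_b\le p+2$ if $w>3$, and $d_b\le p+1$ if $w>5$.
   Context: A Shannon game (link) $(G,s,t)$ consists of a finite simple graph $G$ and two distinct designated vertices $s,t$, the terminals. Two players, Short and Cut, alternately select a not-yet-selected non-terminal vertex; Short claims his vertices, Cut deletes his. Short wins if at the end there is an $s$–$t$ path all of whose internal vertices are claimed by Short; otherwise Cut wins. The link is strong if Short has a winning strategy when moving second, and weak if Short has a winning strategy when moving first but not when moving second. A weak link is minimal if deleting any single edge of $G$ produces a game in which Short has no winning strategy as first player. The weight $w$ is the number of non-terminal vertices. The borders are $B_s=\Gamma(s)$ and $B_t=\Gamma(t)$; a border vertex is a vertex of $B_s\cup B_t$. The centre is the set of vertices that are neither terminals nor in $B_s\cup B_t$, and $p$ is its size. *)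

(* Defs.v *)
From mathcomp Require Import all_boot.

Set Implicit Arguments.
Unset Strict Implicit.
Unset Printing Implicit Defensive.

Section ShannonGame.

Variables (T : finType) (e : rel T) (s t : T).

Definition simple_graph := symmetric e /\ irreflexive e.

Definition nonterminals : {set T} := ~: [set s; t].

Definition weight := #|nonterminals|.

Definition nbhd (x : T) : {set T} := [set y | e x y].

Definition degree (x : T) := #|nbhd x|.

(* The terminals are excluded explicitly: when [s] and [t] are adjacent, each
   belongs to the neighbourhood of the other. *)
Definition border_vertices : {set T} := (nbhd s :|: nbhd t) :&: nonterminals.

Definition centre : {set T} := nonterminals :\: (nbhd s :|: nbhd t).

(* A history lists the selected vertices in order of selection, the moves being
   numbered from 0; the boolean [short_first] tells whether Short moves first. *)
Definition short_turn (short_first : bool) (i : nat) : bool := odd i (+) short_first.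

Definition is_history (h : seq T) : Prop :=
  uniq h /\ {subset h <= nonterminals}.

Definition complete_play (h : seq T) : Prop :=
  is_history h /\ {subset nonterminals <= h}.

Definition claimed (short_first : bool) (h : seq T) : {set T} :=
  [set x in h | short_turn short_first (index x h)].

Definition short_connects (A : {set T}) : Prop :=
  exists q : seq T,
    [/\ path e s (rcons q t), uniq (s :: rcons q t) & {subset q <= A}].

Definition strategy := seq T -> T.

(* Without this requirement a strategy answering with illegal moves would have
   no play following it and would win vacuously. *)
Definition legal_strategy (short_first : bool) (sigma : strategy) : Prop :=
  forall h : seq T, is_history h -> size h < weight ->
    short_turn short_first (size h) ->
    sigma h \in nonterminals /\ sigma h \notin h.

Definition follows (short_first : bool) (sigma : strategy) (h : seq T) : Prop :=
  forall i : nat, i < size h -> short_turn short_first i ->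
    nth s h i = sigma (take i h).

Definition short_wins (short_first : bool) : Prop :=
  exists sigma : strategy, legal_strategy short_first sigma /\
    forall h : seq T, complete_play h -> follows short_first sigma h ->
      short_connects (claimed short_first h).

Definition strong_link : Prop := short_wins false.

Definition weak_link : Prop := short_wins true /\ ~ strong_link.

End ShannonGame.

Definition del_edge (T : finType) (e : rel T) (u v : T) : rel T :=
  fun x y => e x y && ([set x; y] != [set u; v]).

Definition minimal_weak_link (T : finType) (e : rel T) (s t : T) : Prop :=
  weak_link e s t /\
  forall u v : T, e u v -> ~ short_wins (del_edge e u v) s t true.

(* Main.v *)
Require Import Defs.
From mathcomp Require Import all_boot.

(* By minimality, any strategy of Short, as first player, that uses only some of
   the edges shows that there are no others.  Hence no edge joins two neighbours
   of [s], and unless the link has weight at most 3 up to isolated vertices, a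
   border vertex has at most one neighbour in the opposite border; this gives
   [p + 2].

   Suppose that [b] in [B_s] is adjacent to the whole centre and to [d] in [B_t].
   If [b] wins at once, forcing [d], the link has weight 5.  Otherwise the edges
   from non-terminals to [B_t] minus [d] form a matching, and Cut answering along it
   leaves [b] with no use but to threaten [d] and the mates of claimed vertices of
   the centre.  So Short never needs the edge [b u] for an unmatched [u] in the
   centre, and the whole centre is matched.  If a path through the centre joins some
   [a <> b] in [B_s] to [d], Short wins without the edge [b d] by walking along it:
   each vertex of the path threatens its mate, and its connection to [s] is safe
   thanks to [a] and [b].  If there is no such path, Cut wins by pairing [b] with
   [d] and following the matching. *)

Set Implicit Arguments.
Unset Strict Implicit.
Unset Printing Implicit Defensive.

(** * Connection and the recursive form of the game *)

Section Connection.

Variable T : finType.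
Implicit Types (e : rel T) (s t x y : T) (A B F : {set T}).

Definition induced e s t A : rel T :=
  [rel x y | [&& e x y, x \in s |: (t |: A) & y \in s |: (t |: A)]].

Definition connected e s t A := connect (induced e s t A) s t.

Lemma induced_sub e e' s t A A' :
  {in s |: (t |: A) &, subrel e e'} -> A \subset A' ->
  subrel (induced e s t A) (induced e' s t A').
Proof.
move=> ee' AA' x y /and3P[exy xA yA]; have exy' := ee' _ _ xA yA exy.
have sub: s |: (t |: A) \subset s |: (t |: A') by rewrite !setUS.
by apply/and3P; split; rewrite // (subsetP sub).
Qed.

Lemma connected_sub e e' s t A A' :
  {in s |: (t |: A) &, subrel e e'} -> A \subset A' ->
  connected e s t A -> connected e' s t A'.
Proof.
move=> ee' AA'; apply: connect_sub => x y exy.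
by apply/connect1/(induced_sub ee' AA').
Qed.

Lemma connectedS e s t A A' :
  A \subset A' -> connected e s t A -> connected e s t A'.
Proof. by apply: connected_sub => x y _ _. Qed.

Lemma path_connect_induced e s t A x q :
  path e x q -> {subset x :: q <= s |: (t |: A)} ->
  connect (induced e s t A) x (last x q).
Proof.
elim: q x => //= y q IH x /andP[exy yq] sub.
have sub' : {subset y :: q <= s |: (t |: A)}.
  by move=> z zq; apply: sub; rewrite inE zq orbT.
apply: connect_trans (IH y yq sub'); apply: connect1.
apply/and3P; split; first by [].
  by apply: sub; rewrite mem_head.
by apply: sub'; rewrite mem_head.
Qed.

Lemma path_connected e s t A q :
  path e s (rcons q t) -> {subset q <= A} -> connected e s t A.
Proof.
move=> pq qA; rewrite /connected -{2}(last_rcons s q t).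
apply: path_connect_induced => // x; rewrite inE mem_rcons inE.
case/predU1P => [->|/predU1P[->|/qA xA]]; rewrite !inE ?eqxx ?orbT //.
by rewrite xA !orbT.
Qed.

Lemma connectedP e s t A : s != t ->
  reflect (short_connects e s t A) (connected e s t A).
Proof.
move=> st; apply: (iffP idP) => [/connectP[p ep tp]|[q [pq _ qA]]]; last first.
  exact: path_connected pq qA.
case: (shortenP ep) tp => p' ep' up' _ {p ep} tp.
case: (lastP p') ep' up' tp => [_ _ ts|q z ep' up' tz].
  by rewrite ts eqxx in st.
rewrite last_rcons in tz; subst z; exists q; split=> //.
  by apply: sub_path ep' => x y /and3P[].
move=> x xq; move: up'; rewrite cons_uniq rcons_uniq mem_rcons.
rewrite inE negb_or => /and3P[/andP[_ sq] tq _].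
have : all (mem (s |: (t |: A))) (rcons q t).
  apply/allP => y yq; have /pathP := ep'.
  move=> /(_ s) ep; have iy := yq; rewrite -index_mem in iy.
  by have /and3P[_ _] := ep _ iy; rewrite nth_index.
move=> /allP/(_ x); rewrite mem_rcons inE xq orbT => /(_ isT) /=.
by rewrite !inE => /or3P[/eqP xs|/eqP xt|//]; 
  [rewrite -xs xq in sq | rewrite -xt xq in tq].
Qed.

Lemma connected_sym e s t A :
  symmetric e -> connected e s t A -> connected e t s A.
Proof.
move=> se; rewrite /connected connect_rev; congr is_true.
apply: eq_connect => x y; rewrite /induced /= se andbA andbAC -andbA.
by congr [&& _, _ & _]; rewrite setUCA.
Qed.

End Connection.

(** * The recursive game and Cut's pairing strategies *)

Section Game.

Variable T : finType.
Implicit Types (g h : {set T} -> bool) (A B F : {set T}) (m v x : T).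

(* Short, to move, wins when [A] is the set of his vertices and [F] the set of
   free ones.  Cut's answer [v] ranges over all of [T]: a non-free [v] is a pass,
   which never helps Cut and makes the last move of the game unexceptional. *)
Inductive win g A F : Prop :=
| WinNow of g A
| WinMove m of m \in F & forall v, win g (m |: A) (F :\ m :\ v).

(** Short copies the moves of a game that he wins elsewhere. Both games then add the same set [B] of
    vertices free in the first one, so the goals need comparing only on such sets. *)
Lemma win_sub g h A A' F F' :
  F \subset F' -> (forall B, B \subset F -> g (A :|: B) -> h (A' :|: B)) ->
  win g A F -> win h A' F'.
Proof.
move=> FF' gh w; elim: w A' F' FF' gh => {A F} A F.
  by move=> gA A' F' _ /(_ set0); rewrite sub0set !setU0 => /(_ isT gA); left.
move=> m mF _ IH A' F' FF' gh; apply: (@WinMove _ _ _ m).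
  exact: (subsetP FF').
move=> v; apply: (IH v) => [|B BF]; first by do 2!apply: setSD.
rewrite -!(setUA [set m]) !(setUCA [set m]); apply: gh.
apply/subsetP => x /setU1P[->//|/(subsetP BF)].
by rewrite !inE => /and3P[].
Qed.

Lemma win_mono g h A F F' :
  F \subset F' -> (forall B, g B -> h B) -> win g A F -> win h A F'.
Proof. by move=> FF' gh; apply: win_sub => // B _; apply: gh. Qed.

Lemma win_step g A F : (forall B B', B \subset B' -> g B -> g B') ->
  win g A F -> F != set0 ->
  exists2 m, m \in F & forall v, win g (m |: A) (F :\ m :\ v).
Proof.
move=> mg [gA /set0Pn[m mF]|m mF w _]; last by exists m.
by exists m => // v; left; apply: mg gA; apply: subsetUr.
Qed.

Lemma win_set0 g A : win g A set0 -> g A.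
Proof. by case=> // m; rewrite inE. Qed.

(** A decidable form of [win], with [n] bounding the number of rounds; it lets a strategy search for
    a winning move. *)
Fixpoint winb g n A F := g A ||
  (if n is n'.+1 then
     [exists m in F, [forall v, winb g n' (m |: A) (F :\ m :\ v)]]
   else false).

Lemma winP g n A F : #|F| <= n -> reflect (win g A F) (winb g n A F).
Proof.
elim: n A F => [|n IH] A F Fn.
  have ->: F = set0 by apply/eqP; rewrite -cards_eq0 -leqn0.
  by rewrite /= orbF; apply: (iffP idP) => [|/win_set0//]; left.
have le m v : m \in F -> #|F :\ m :\ v| <= n.
  move=> mF; rewrite -ltnS; apply: leq_trans Fn.
  by rewrite (cardsD1 m F) mF ltnS subset_leq_card // subsetDl.
apply: (iffP orP) => [[gA|/existsP[m /andP[mF /forallP w]]]|[gA|m mF w]].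
- by left.
- by apply: (@WinMove _ _ _ m) => // v; apply/IH; rewrite ?le.
- by left.
right; apply/existsP; exists m; rewrite mF; apply/forallP => v.
by apply/IH; rewrite ?le.
Qed.

(** Cut answers every move by its partner under [pr]. Partners of claimed vertices are out of
    Short's reach at the start, and the answers preserve this, so Short never holds a whole pair. *)
Lemma pairing_cut g (pr : rel T) A F :
  symmetric pr -> irreflexive pr -> (forall x y z, pr x y -> pr x z -> y = z) ->
  (forall x y, pr x y -> x \in A -> y \notin A :|: F) ->
  (forall B, B \subset A :|: F ->
    (forall x y, pr x y -> x \in B -> y \notin B) -> ~~ g B) ->
  ~ win g A F.
Proof.
move=> spr ipr fpr inv gF w; elim: w inv gF => {A F} A F.
  move=> gA inv /(_ A); rewrite subsetUl gA => H; suff: false by [].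
  by apply: H => // x y /inv H /H; rewrite inE; case/norP.
move=> m mF _ IH inv gF.
(* With no partner to take, Cut passes: [m] itself is no longer free. *)
pose v := odflt m [pick y | pr m y].
have vP y : pr m y -> y = v.
  rewrite /v; case: pickP => [z mz my|/(_ y)->//]; exact: fpr my mz.
apply: (IH v) => [x y xy|B BAF].
  have yx : pr y x by rewrite spr.
  rewrite !inE => /predU1P[xm|xA].
    subst x; rewrite -(vP y xy) eqxx orbF /=; apply/norP; split.
      by apply: contraL xy => /eqP->; rewrite ipr.
    by apply/negP => yA; have := inv _ _ yx yA; rewrite inE mF orbT.
  have := inv _ _ xy xA; rewrite inE => /norP[yA yF].
  rewrite (negbTE yA) (negbTE yF) !andbF !orbF.
  by apply: contraNneq yF => ->.
apply: gF; apply: subset_trans BAF _; apply/subsetP => x; rewrite !inE.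
by case/orP=> [/predU1P[->|->//]|/and3P[_ _ ->]]; rewrite ?mF ?orbT.
Qed.

End Game.

(** * Agreement with strategies defined on histories *)

Section ShortWins.

Variables (T : finType) (e : rel T) (s t : T).
Hypothesis st : s != t.
Local Notation N := (nonterminals s t).
Local Notation g := (connected e s t).
Implicit Types (h : seq T) (m v x y : T).

Lemma claimed_rcons h x : uniq (rcons h x) ->
  claimed true (rcons h x) =
  (if odd (size h) then claimed true h else x |: claimed true h).
Proof.
rewrite rcons_uniq => /andP[xh _].
have E y : (y \in claimed true (rcons h x)) =
    if y == x then ~~ odd (size h) else y \in claimed true h.
  rewrite !inE mem_rcons inE -cats1 index_cat.
  case: eqP => [->|/eqP yx] /=.
    by rewrite (negbTE xh) /= eqxx addn0 /short_turn addbT.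
  by case: ifP => //= yh.
apply/setP => y; rewrite E; case: eqP => [->|/eqP yx].
  by case: odd; rewrite ?inE ?eqxx //= (negbTE xh).
by case: odd; rewrite ?in_setU1 ?(negbTE yx).
Qed.

Lemma mem_free h x : (x \in N :\: [set y in h]) = (x \in N) && (x \notin h).
Proof. by rewrite !inE andbC. Qed.

Lemma free_rcons h x : N :\: [set y in rcons h x] = (N :\: [set y in h]) :\ x.
Proof. by apply/setP => y; rewrite !inE mem_rcons inE negb_or -andbA. Qed.

(** Induction on the number of free vertices: every position reached by following [sigma], with
    Short to move, is winning. *)
Lemma short_wins_win : short_wins e s t true -> win g set0 N.
Proof.
case=> sigma [leg wins].
have main n : forall h, is_history s t h -> follows s true sigma h ->
   ~~ odd (size h) -> #|N :\: [set y in h]| <= n ->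
   win g (claimed true h) (N :\: [set y in h]).
  elim: n => [|n IH] h hh fh oh Fn.
    left; apply/connectedP => //; apply: wins => //; split=> // x xN.
    move: Fn; rewrite leqn0 cards_eq0 => /eqP/setP/(_ x).
    by rewrite mem_free xN inE /= => /negbFE.
  have [F0|/set0Pn[z]] := eqVneq (N :\: [set y in h]) set0.
    left; apply/connectedP => //; apply: wins => //; split=> // x xN.
    by move: F0 => /setP/(_ x); rewrite mem_free xN inE /= => /negbFE.
  rewrite mem_free => /andP[zN zh].
  have hw : size h < weight s t.
    have /card_uniqP <- := hh.1; apply: proper_card; apply/properP; split.
      by apply/subsetP => x /hh.2.
    by exists z.
  have ht : short_turn true (size h) by rewrite /short_turn addbT.
  have [mN mh] := leg h hh hw ht; set m := sigma h in mN mh.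
  have hm : is_history s t (rcons h m).
    split; first by rewrite rcons_uniq mh hh.1.
    by move=> x; rewrite mem_rcons inE => /predU1P[->//|/hh.2].
  have fm : follows s true sigma (rcons h m).
    move=> i; rewrite size_rcons ltnS leq_eqVlt => /predU1P[->|ih] ti.
      by rewrite nth_rcons ltnn eqxx -cats1 take_cat ltnn subnn take0 cats0.
    by rewrite nth_rcons ih fh // -cats1 takel_cat // ltnW.
  have cm : claimed true (rcons h m) = m |: claimed true h.
    by rewrite claimed_rcons ?(negbTE oh) // hm.1.
  have mF : m \in N :\: [set y in h] by rewrite mem_free mN.
  have next v : v \in N :\: [set y in h] :\ m ->
      win g (m |: claimed true h) (N :\: [set y in h] :\ m :\ v).
    move=> vF; rewrite -!free_rcons -cm.
    have vhm : v \notin rcons h m by move: vF; rewrite -free_rcons mem_free => /andP[].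
    have vN : v \in N by move: vF; rewrite -free_rcons mem_free => /andP[].
    have uv : uniq (rcons (rcons h m) v) by rewrite rcons_uniq vhm hm.1.
    have -> : claimed true (rcons h m) = claimed true (rcons (rcons h m) v).
      by rewrite (claimed_rcons uv) size_rcons /= oh.
    apply: IH.
    - by split=> // x; rewrite mem_rcons inE => /predU1P[->//|/hm.2].
    - move=> i; rewrite size_rcons ltnS leq_eqVlt => /predU1P[->|ih] ti.
        by move: ti; rewrite size_rcons /short_turn /= oh.
      by rewrite nth_rcons ih fm // -(cats1 _ v) takel_cat // ltnW.
    - by rewrite !size_rcons /= negbK.
    rewrite !free_rcons -ltnS; apply: leq_trans Fn.
    rewrite (cardsD1 m (_ :\: [set y in h])) mF ltnS.
    by rewrite subset_leq_card // subsetDl.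
  apply: (@WinMove _ _ _ _ m) => // v.
  have [/next//|vF] := boolP (v \in N :\: [set y in h] :\ m).
  (* Here Cut passes. Either the play is complete, or Short wins after some real answer [v0], hence
     also after the pass, which leaves him more free vertices. *)
  have [F0|/set0Pn[v0 v0F]] := eqVneq (N :\: [set y in h] :\ m) set0.
    left; apply/connectedP => //; rewrite -cm; apply: wins => //; split=> // x xN.
    by move: F0 => /setP/(_ x); rewrite -free_rcons mem_free xN inE /= => /negbFE.
  apply: win_mono (next _ v0F) => //; apply/subsetP => x xF; rewrite in_setD1.
  move: xF; rewrite in_setD1 => /andP[_ xF]; rewrite xF andbT.
  by apply: contraNneq vF => <-.
have -> : (set0 : {set T}) = claimed true [::] by apply/setP => x; rewrite !inE.
have -> : N = N :\: [set y in [::]] by apply/setP => x; rewrite !inE.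
exact: (main _ [::]).
Qed.

Lemma win_short_wins : win g set0 N -> short_wins e s t true.
Proof.
move=> w0.
pose good h m := [forall v, winb g #|T| (m |: claimed true h)
                                  (N :\: [set y in h] :\ m :\ v)].
pose free h := N :\: [set y in h].
(* A winning move if there is one, and otherwise any free vertex, which keeps the strategy legal on
   all histories. The default [s] is reached only when no vertex is free. *)
pose sigma h := if [pick m in free h | good h m] is Some m then m
                else odflt s [pick m in free h].
exists sigma; split=> [h [uh hN] hw _|h [[uh hN] Nh] fh].
  rewrite /sigma; case: pickP => [m /andP[]|_].
    by rewrite mem_free => /andP[].
  case: pickP => [m|F0]; first by rewrite mem_free => /andP[].
  exfalso.
  move: hw; rewrite ltnNge -(card_uniqP uh) => /negP; apply; apply: subset_leq_card.
  apply/subsetP => x xN; have := F0 x; rewrite mem_free xN /= => /negbFE.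
  by [].
(* After an odd number of moves Cut is to play, so the win must hold whichever [v] he removes. *)
have inv i : i <= size h ->
   if odd i then forall v, win g (claimed true (take i h)) (free (take i h) :\ v)
   else win g (claimed true (take i h)) (free (take i h)).
  elim: i => [_|i IH ih].
    rewrite take0; suff -> : claimed true [::] = set0 :> {set T}.
      by suff -> : free [::] = N by []; apply/setP => x; rewrite !inE.
    by apply/setP => x; rewrite !inE.
  have := IH (ltnW ih); rewrite (take_nth s) //=; set x := nth s h i.
  have ui : uniq (rcons (take i h) x) by rewrite -take_nth // take_uniq.
  rewrite claimed_rcons // size_takel ?(ltnW ih) // /free free_rcons.
  case: ifP => /= [oi|/negbT oi wi]; first exact.
  have xF : x \in free (take i h).
    rewrite mem_free hN ?mem_nth //=; by move: ui; rewrite rcons_uniq => /andP[].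
  have F0 : free (take i h) != set0 by apply/set0Pn; exists x.
  have [m mF wm] := win_step (fun B B' => @connectedS T e s t B B') wi F0.
  have : good (take i h) x.
    have ti : short_turn true i by rewrite /short_turn addbT.
    rewrite [x](fh i ih ti) /sigma.
    case: pickP => [m' /andP[]//|/(_ m)].
    rewrite mF /= => /negbT/negP[]; apply/forallP => v; apply/winP => //.
    exact: max_card.
  by move=> /forallP H v; apply/(winP _ _ _)/H; apply: max_card.
have := inv _ (leqnn _); rewrite take_size.
have F0 : free h = set0.
  apply/setP => x; rewrite mem_free in_set0.
  by case xN: (x \in N) => //=; rewrite (Nh _ xN).
rewrite F0; case: odd => [/(_ s)|]; rewrite ?set0D => /win_set0 /connectedP; exact.
Qed.

End ShortWins.

(** * Minimality and links of small weight *)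

Section DelEdge.

Variables (T : finType) (e : rel T).
Implicit Types u v x y : T.

Lemma del_edgeE u v x y :
  del_edge e u v x y =
  e x y && ~~ ((x == u) && (y == v) || (x == v) && (y == u)).
Proof.
rewrite /del_edge; congr (_ && ~~ _); apply/eqP/orP => [E|].
  have := set21 x y; have := set22 x y; rewrite E !inE.
  have := set21 u v; have := set22 u v; rewrite -E !inE.
  rewrite ![u == _]eq_sym ![v == _]eq_sym.
  case: (x == u) (x == v) (y == u) (y == v) => -[] [] [] //=; auto.
by case=> /andP[/eqP-> /eqP->] //; rewrite setUC.
Qed.

Lemma del_edge_l u v x y : x != u -> y != u -> e x y -> del_edge e u v x y.
Proof. by rewrite del_edgeE => /negbTE-> /negbTE-> ->; rewrite andbF. Qed.

Lemma del_edge_r u v x y : x != v -> y != v -> e x y -> del_edge e u v x y.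
Proof. by rewrite del_edgeE => /negbTE-> /negbTE-> ->; rewrite andbF. Qed.

Lemma del_edge_sym u v : symmetric e -> symmetric (del_edge e u v).
Proof. by move=> se x y; rewrite /del_edge se setUC. Qed.

End DelEdge.

Definition wins_first (T : finType) (e : rel T) (s t : T) :=
  win (connected e s t) set0 (nonterminals s t).

Definition minimal_win (T : finType) (e : rel T) (s t : T) :=
  wins_first e s t /\ forall u v, e u v -> ~ wins_first (del_edge e u v) s t.

Section Minimal.

Variables (T : finType) (e : rel T).
Hypotheses (se : symmetric e) (ie : irreflexive e).
Implicit Types (s t u v x y : T) (L : seq (T * T)).

Lemma minimal_weak_link_win s t : s != t ->
  minimal_weak_link e s t -> minimal_win e s t.
Proof.
move=> st [[w _] m]; split; first exact: short_wins_win.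
by move=> u v euv w'; apply: (m u v euv); apply: win_short_wins.
Qed.

Lemma wins_first_sym (e' : rel T) s t :
  symmetric e' -> wins_first e' s t -> wins_first e' t s.
Proof.
move=> se'; have -> : wins_first e' t s = win (connected e' t s) set0 (nonterminals s t).
  by rewrite /wins_first /nonterminals setUC.
by apply: win_mono => // B; apply: connected_sym.
Qed.

Lemma minimal_win_sym s t : minimal_win e s t -> minimal_win e t s.
Proof.
move=> [w m]; split; first exact: wins_first_sym.
by move=> u v /m m' /(wins_first_sym (del_edge_sym u v se))/m'.
Qed.

Section Sparse.

Variables s t : T.
Hypothesis em : minimal_win e s t.
Local Notation N := (nonterminals s t).
Local Notation p := #|centre e s t|.

Lemma in_N x : (x \in N) = (x != s) && (x != t).
Proof. by rewrite !inE negb_or. Qed.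

(** An edge of [e] missing from [e'] could be deleted without harming Short's win in [e']. Both
    orientations appear because [e'] may be asymmetric. *)
Lemma minimal_edges (e' : rel T) x y :
  subrel e' e -> wins_first e' s t -> e x y -> e' x y || e' y x.
Proof.
move=> e'e w' exy; apply: contraT => /norP[nxy nyx].
case: (em.2 x y exy); apply: win_mono w' => // B; apply: connected_sub => //.
move=> u v _ _ e'uv; rewrite del_edgeE e'e //=; apply/negP.
by case/orP=> /andP[/eqP ux /eqP vy]; subst; rewrite e'uv in nxy nyx.
Qed.

(** Edges are listed in one direction only, the one in which Short's paths run from [s] to [t]. *)
Definition edges_of L : rel T := [rel x y | (x, y) \in L].

(** If Short wins on the listed edges alone, there are no others, so a non-terminal vertex outside
    [V] is isolated. *)
Lemma minimal_support L V x y : all (fun p => e p.1 p.2) L ->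
  all (fun p => (p.1 \in s :: t :: V) && (p.2 \in s :: t :: V)) L ->
  wins_first (edges_of L) s t -> e x y -> x \in N -> x \in V.
Proof.
move=> /allP Le /allP LV w exy; rewrite in_N => /andP[/negbTE xs /negbTE xt].
have : x \in s :: t :: V.
  have sub : subrel (edges_of L) e by move=> u v /Le.
  by case/orP: (minimal_edges sub w exy) => /LV /= /andP[].
by rewrite !inE xs xt.
Qed.

(** Isolated vertices belong to the centre and are absorbed by [p]; only the borders must be covered
    by [V]. *)
Lemma weight_le (V : seq T) :
  (forall x, x \in N -> e s x || e t x -> x \in V) -> weight s t <= size V + p.
Proof.
move=> H; have : N \subset [set x in V] :|: centre e s t.
  apply/subsetP => x xN; rewrite in_setU inE in_setD xN andbT in_setU !in_set.
  by case: (boolP (e s x || e t x)) => [/(H x xN)->|]; rewrite ?orbT.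
move=> /subset_leq_card/leq_trans; apply.
apply: leq_trans (leq_card_setU _ _) _; rewrite leq_add2r cardsE; exact: card_size.
Qed.

Lemma degree_le (D : seq T) x : (forall y, e x y -> y \in D) -> degree e x <= size D.
Proof.
move=> H; apply: leq_trans (card_size D); apply: subset_leq_card.
by apply/subsetP => y; rewrite inE => /H.
Qed.

End Sparse.

End Minimal.

Ltac connect_by q :=
  apply: (@path_connected _ _ _ _ _ q);
  [ by rewrite /edges_of /= ?inE ?eqxx ?orbT
  | apply/allP; by rewrite /= ?inE ?eqxx ?orbT ].

Definition degree_bound (T : finType) (e : rel T) (s t b : T) :=
  (3 < weight s t -> degree e b <= #|centre e s t| + 2) /\
  (5 < weight s t -> degree e b <= #|centre e s t| + 1).

(** * Degenerate links, and edges inside a border *)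

Section SmallLinks.

Variables (T : finType) (e : rel T).
Hypotheses (se : symmetric e) (ie : irreflexive e).
Variables s t : T.
Hypothesis em : minimal_win e s t.
Local Notation N := (nonterminals s t).
Implicit Types b x y d : T.

Lemma edge_neq x y : e x y -> x != y.
Proof. by apply: contraTneq => ->; rewrite ie. Qed.

Lemma terminals_not_adjacent b : b \in N -> e s b || e t b -> ~~ e s t.
Proof.
move=> bN eb; apply/negP => est.
have [y] : exists y, e b y by case/orP: eb; rewrite se; [exists s|exists t].
move=> eby; suff: b \in [::] by [].
apply: (minimal_support (L := [:: (s, t)]) em _ _ _ eby) => //=.
- by rewrite est.
- by rewrite !inE !eqxx orbT.
- by left; connect_by (@nil T).
Qed.

(** A weight above 3 forces a centre of size at least 1, and a weight above 5 one of size at least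
    3. *)
Lemma small_link_bound b : weight s t <= 3 + #|centre e s t| -> degree e b <= 3 ->
  degree_bound e s t b.
Proof.
rewrite /degree_bound; move: #|centre e s t| => n wn db.
by split=> lw; apply: leq_trans db _; move: (leq_trans lw wn); case: n {wn} => [|[|n]];
  rewrite ?addn1 ?addn2.
Qed.

(** Claiming [x] wins at once, so the link is the path through [x] together with isolated
    vertices. *)
Lemma common_border_bound x b : b \in N -> e s x -> e x t -> degree_bound e s t b.
Proof.
move=> bN esx ext; pose L := [:: (s, x); (x, t)].
have xN : x \in N by rewrite in_N eq_sym !edge_neq.
have w : wins_first (edges_of L) s t.
  apply: (@WinMove _ _ _ _ x) => // v; left; connect_by [:: x].
have Le : all (fun p => e p.1 p.2) L by rewrite /= esx ext.
have LV : all (fun p => (p.1 \in s :: t :: [:: x]) && (p.2 \in s :: t :: [:: x])) L.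
  by rewrite /= !inE !eqxx ?orbT.
have wp : weight s t <= 3 + #|centre e s t|.
  apply: (@leq_trans (1 + #|centre e s t|)); last by rewrite leq_add2r.
  apply: (@weight_le _ _ _ _ [:: x]) => z zN ez.
  have [y] : exists y, e z y by case/orP: ez; rewrite se; [exists s|exists t].
  by move=> ezy; apply: (minimal_support em Le LV w ezy).
have db : degree e b <= 3.
  apply: (@leq_trans 2) => //.
  apply: (@degree_le _ _ [:: s; t]) => y eby.
  have sub : subrel (edges_of L) e by move=> u v /(allP Le).
  have /= := minimal_edges em sub w eby; rewrite /edges_of /= !inE !xpair_eqE.
  move: bN; rewrite in_N => /andP[/negbTE-> /negbTE->].
  by case: (y == s); case: (y == t); rewrite // ?andbF.
exact: small_link_bound.
Qed.

(** Claiming [x] threatens both [d1] and [d2], so the five edges involved are all there are. *)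
Lemma two_neighbours_bound x d1 d2 b : ~~ e s t -> (forall y, e s y -> ~~ e y t) ->
  b \in N -> d1 != d2 ->
  e s x -> e x d1 -> e x d2 -> e d1 t -> e d2 t -> degree_bound e s t b.
Proof.
move=> nst dis bN d12 esx ex1 ex2 e1t e2t.
pose L := [:: (s, x); (x, d1); (x, d2); (d1, t); (d2, t)].
have ns y : e y t -> y != s by apply: contraTneq => ->.
have xN : x \in N.
  rewrite in_N eq_sym edge_neq //=; by apply: contraNneq nst => <-.
have d1N : d1 \in N by rewrite in_N ns ?edge_neq.
have d2N : d2 \in N by rewrite in_N ns ?edge_neq.
have w : wins_first (edges_of L) s t.
  apply: (@WinMove _ _ _ _ x) => // v.
  have [->|vd1] := eqVneq v d1.
    apply: (@WinMove _ _ _ _ d2) => [|v']; last by left; connect_by [:: x; d2].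
    by rewrite !in_setD1 d2N eq_sym d12 eq_sym edge_neq.
  apply: (@WinMove _ _ _ _ d1) => [|v']; last by left; connect_by [:: x; d1].
  by rewrite !in_setD1 d1N eq_sym vd1 eq_sym edge_neq.
have Le : all (fun p => e p.1 p.2) L by rewrite /= esx ex1 ex2 e1t e2t.
pose V := [:: x; d1; d2].
have LV : all (fun p => (p.1 \in s :: t :: V) && (p.2 \in s :: t :: V)) L.
  by rewrite /= !inE !eqxx ?orbT.
have wp : weight s t <= 3 + #|centre e s t|.
  apply: (@weight_le _ _ _ _ V) => z zN ez.
  have [y] : exists y, e z y by case/orP: ez; rewrite se; [exists s|exists t].
  by move=> ezy; apply: (minimal_support em Le LV w ezy).
have db : degree e b <= 3.
  have sub : subrel (edges_of L) e by move=> u v /(allP Le).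
  have E y : e b y -> ((b, y) \in L) || ((y, b) \in L).
    by move=> eby; apply: (minimal_edges em sub w eby).
  move: bN; rewrite in_N => /andP[/negbTE bs /negbTE bt].
  have [bx|/negbTE bx] := eqVneq b x.
    apply: (@degree_le _ _ [:: s; d1; d2]) => y /E.
    rewrite !inE !xpair_eqE bs bt bx.
    rewrite (negbTE (edge_neq ex1)) (negbTE (edge_neq ex2)) !eqxx !andbF !andbT !orbF /=.
    by case: (y == s); case: (y == d1); case: (y == d2); rewrite // ?orbT.
  apply: (@leq_trans (size [:: x; t])) => //.
  apply: degree_le => y /E; rewrite !inE !xpair_eqE bs bt bx !andbF /=.
  by case: (y == x); case: (y == t); rewrite // ?orbT ?andbF.
exact: small_link_bound.
Qed.

(* Both ends of the edge are reachable from [s] in one step, so a path through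
   it can be shortened. *)
Lemma no_border_edge x y : ~~ e s t -> e s x -> e s y -> ~~ e x y.
Proof.
move=> nst esx esy; apply/negP => exy; case: (em.2 x y exy).
apply: win_mono em.1 => // B /connectP[p ep tp]; rewrite /connected.
rewrite [in X in connect _ _ X]tp {tp}.
set r := induced _ s t B.
suff: forall z, path (induced e s t B) z p -> connect r s z ->
  connect r s (last z p) by apply.
elim: p {ep} => //= z2 p IH z /andP[/and3P[ezz zB z2B] pp] cz.
apply: (IH z2 pp); have [dz|] := boolP (del_edge e x y z z2).
  apply: connect_trans cz _; apply/connect1; rewrite /r /=; exact/and3P.
rewrite del_edgeE ezz negbK /= => H.
have ez2 : e s z2 by case/orP: H => /andP[_ /eqP->].
apply: connect1; apply/and3P; split; last exact: z2B.
  by rewrite del_edgeE ez2 (negbTE (edge_neq esx)) (negbTE (edge_neq esy)).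
exact: setU11.
Qed.

End SmallLinks.

(** * A border vertex adjacent to the whole centre *)

Section FullBorderVertex.

Variables (T : finType) (e : rel T) (s t b d : T).
Hypotheses (se : symmetric e) (ie : irreflexive e) (st : s != t).
Hypotheses (em : minimal_win e s t) (w5 : 5 < weight s t).
Local Notation N := (nonterminals s t).
Implicit Types (u v x y z : T) (A B F : {set T}).

Hypotheses (nst : ~~ e s t) (disj : forall x, e s x -> ~~ e x t).
Hypothesis one_t : forall x y1 y2,
  e s x -> e x y1 -> e x y2 -> e y1 t -> e y2 t -> y1 = y2.
Hypothesis one_s : forall y x1 x2,
  e y t -> e x1 y -> e x2 y -> e s x1 -> e s x2 -> x1 = x2.
Hypothesis noT : forall x y, e x t -> e y t -> ~~ e x y.
Hypotheses (esb : e s b) (ebd : e b d) (edt : e d t).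
Hypothesis bC : forall c, c \in centre e s t -> e b c.

Lemma centreP x : x \in N -> ~~ e s x -> ~~ e x t -> x \in centre e s t.
Proof. by move=> xN sx xt; rewrite in_setD xN andbT in_setU !in_set negb_or sx se. Qed.

Lemma borderN x : e s x -> x \in N.
Proof.
move=> esx; rewrite in_N eq_sym (edge_neq ie esx) /=.
by apply: contraNneq nst => <-.
Qed.

Lemma borderN' x : e x t -> x \in N.
Proof.
move=> ext; rewrite in_N (edge_neq ie ext) andbT.
by apply: contraNneq nst => <-.
Qed.

Lemma bN : b \in N. Proof. exact: borderN. Qed.
Lemma dN : d \in N. Proof. exact: borderN'. Qed.

Lemma disj' x : e x t -> ~~ e s x. Proof. by apply: contraTN => /disj. Qed.

Lemma bd : b != d. Proof. exact: edge_neq ebd. Qed.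

Lemma b_only_d y : e b y -> e y t -> y = d.
Proof. by move=> eby eyt; apply: one_t esb eby ebd eyt edt. Qed.

Lemma neq_bt y : e y t -> y != b.
Proof. by apply: contraTneq => ->; apply: disj. Qed.

(* Were these edges not a matching, Short would win by starting with [b] (forcing
   [d]) on a link of weight 5. *)
Definition matched z y := [&& z != t, e z y, e y t & y != d].

(** Otherwise Short claims [b], forcing Cut to take [d], then [y], and completes a path with [z1] or
    [z2], each joined to [s] directly or through [b]. Five non-terminal vertices suffice, against
    [w5]. *)
Lemma matched_l z1 z2 y : matched z1 y -> matched z2 y -> z1 = z2.
Proof.
move=> /and4P[z1t z1y yt yd] /and4P[z2t z2y _ _]; apply/eqP/negPn/negP => z12.
have zs z : e z y -> z != s by apply: contraTneq => ->; apply: disj'.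
have z1N : z1 \in N by rewrite in_N zs.
have z2N : z2 \in N by rewrite in_N zs.
have zb z : e z y -> z != b.
  by apply: contraTneq => ->; apply: contra yd => /b_only_d ->.
have zd z : e z y -> z != d by apply: contraTneq => ->; apply: noT.
have root z : z \in N -> e z y -> exists2 r, (r == s) || (r == b) & e r z.
  move=> zN zy; have [sz|sz] := boolP (e s z); first by exists s; rewrite ?eqxx.
  exists b; rewrite ?eqxx ?orbT //; apply/bC/centreP => //.
  by apply: contraTN zy => zt; apply: noT.
have [r1 r1P r1z] := root _ z1N z1y; have [r2 r2P r2z] := root _ z2N z2y.
pose L := [:: (s, b); (b, d); (d, t); (r1, z1); (r2, z2); (z1, y); (z2, y); (y, t)].
pose V := [:: b; d; y; z1; z2].
have Le : all (fun p => e p.1 p.2) L.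
  by rewrite /= esb ebd edt r1z r2z z1y z2y yt.
have LV : all (fun p => (p.1 \in s :: t :: V) && (p.2 \in s :: t :: V)) L.
  have rV r : (r == s) || (r == b) -> r \in s :: t :: V.
    by rewrite !inE => /orP[] ->; rewrite ?orbT.
  by rewrite /= (rV _ r1P) (rV _ r2P) !inE !eqxx ?orbT.
have w : wins_first (edges_of L) s t.
  apply: (@WinMove _ _ _ _ b) => [|v]; first exact: bN.
  have [->|vd] := eqVneq v d; last first.
    apply: (@WinMove _ _ _ _ d) => [|v']; last by left; connect_by [:: b; d].
    by rewrite !in_setD1 dN eq_sym vd eq_sym bd.
  apply: (@WinMove _ _ _ _ y) => [|v'].
    by rewrite !in_setD1 borderN' // yd neq_bt.
  have win_z r z : (r == s) || (r == b) -> (r, z) \in L -> (z, y) \in L ->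
      connected (edges_of L) s t (z |: (y |: (b |: set0))).
    have sbL : (s, b) \in L by rewrite mem_head.
    have ytL : (y, t) \in L by rewrite !inE eqxx !orbT.
    case/orP=> /eqP-> rz zyL.
      apply: (@path_connected _ _ _ _ _ [:: z; y]); first by rewrite /edges_of /= rz zyL ytL.
      by apply/allP; rewrite /= !inE !eqxx ?orbT.
    apply: (@path_connected _ _ _ _ _ [:: b; z; y]).
      by rewrite /edges_of /= sbL rz zyL ytL.
    by apply/allP; rewrite /= !inE !eqxx ?orbT.
  have [->|v1] := eqVneq v' z1.
    apply: (@WinMove _ _ _ _ z2) => [|v2]; last first.
      by left; apply: (win_z r2); rewrite ?r2P // !inE eqxx ?orbT.
    by rewrite !in_setD1 z2N eq_sym z12 (edge_neq ie z2y) zd ?zb.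
  apply: (@WinMove _ _ _ _ z1) => [|v2]; last first.
    by left; apply: (win_z r1); rewrite ?r1P // !inE eqxx ?orbT.
  by rewrite !in_setD1 z1N eq_sym v1 (edge_neq ie z1y) zd ?zb.
move: w5; rewrite ltnNge => /negP; apply.
apply: (@leq_trans #|[set x in V]|); last by rewrite cardsE; apply: (card_size V).
apply/subset_leq_card/subsetP => x xN; rewrite inE.
(* No vertex is isolated, since [b] is adjacent to the whole centre; so [V] bounds the weight
   itself. *)
have [x' exx'] : exists x', e x x'.
  have [sx|sx] := boolP (e s x); first by exists s; rewrite se.
  have [xt|xt] := boolP (e x t); first by exists t.
  by exists b; rewrite se bC // centreP.
exact: (minimal_support em Le LV w exx').
Qed.

(** For [z] in the centre: Short claims [b], forcing [d], then [z], which threatens [y1] and [y2];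
    again the weight would be at most 5. *)
Lemma matched_r z y1 y2 : matched z y1 -> matched z y2 -> y1 = y2.
Proof.
move=> /and4P[zt zy1 y1t y1d] /and4P[_ zy2 y2t y2d].
have [sz|sz] := boolP (e s z); first exact: one_t sz zy1 zy2 y1t y2t.
have zs : z != s by apply: contraTneq zy1 => ->; apply: disj'.
have zN : z \in N by rewrite in_N zs.
have zC : z \in centre e s t.
  by apply: centreP => //; apply: contraTN zy1 => zt'; apply: noT.
have ebz := bC zC.
apply/eqP/negPn/negP => y12.
pose L := [:: (s, b); (b, d); (d, t); (b, z); (z, y1); (z, y2); (y1, t); (y2, t)].
pose V := [:: b; d; z; y1; y2].
have Le : all (fun p => e p.1 p.2) L.
  by rewrite /= esb ebd edt ebz zy1 zy2 y1t y2t.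
have LV : all (fun p => (p.1 \in s :: t :: V) && (p.2 \in s :: t :: V)) L.
  by rewrite /= !inE !eqxx ?orbT.
have w : wins_first (edges_of L) s t.
  apply: (@WinMove _ _ _ _ b) => [|v]; first exact: bN.
  have [->|vd] := eqVneq v d; last first.
    apply: (@WinMove _ _ _ _ d) => [|v']; last by left; connect_by [:: b; d].
    by rewrite !in_setD1 dN eq_sym vd eq_sym bd.
  have zd : z != d by apply: contraTneq zy1 => ->; apply: noT.
  apply: (@WinMove _ _ _ _ z) => [|v'].
    by rewrite !in_setD1 zN zd eq_sym (edge_neq ie ebz).
  have [->|v1] := eqVneq v' y1.
    apply: (@WinMove _ _ _ _ y2) => [|v2]; last by left; connect_by [:: b; z; y2].
    by rewrite !in_setD1 borderN' // eq_sym y12 eq_sym (edge_neq ie zy2) y2d neq_bt.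
  apply: (@WinMove _ _ _ _ y1) => [|v2]; last by left; connect_by [:: b; z; y1].
  by rewrite !in_setD1 borderN' // eq_sym v1 eq_sym (edge_neq ie zy1) y1d neq_bt.
move: w5; rewrite ltnNge => /negP; apply.
apply: (@leq_trans #|[set x in V]|); last by rewrite cardsE; apply: (card_size V).
apply/subset_leq_card/subsetP => x xN; rewrite inE.
have [x' exx'] : exists x', e x x'.
  have [sx|sx] := boolP (e s x); first by exists s; rewrite se.
  have [xt|xt] := boolP (e x t); first by exists t.
  by exists b; rewrite se bC // centreP.
exact: (minimal_support em Le LV w exx').
Qed.

Lemma matched_not_b y : ~~ matched b y.
Proof.
by apply/negP => /and4P[_ eby yt]; rewrite (b_only_d eby yt) eqxx.
Qed.

Lemma matched_rt z y : matched z y -> e y t. Proof. by case/and4P. Qed.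

Lemma matched_lt z y : matched z y -> ~~ e z t.
Proof. by case/and4P=> _ ezy yt _; apply: contraTN ezy => zt; apply: noT. Qed.

Lemma matched_neq z y : matched z y -> z != y.
Proof. by case/and4P=> _ /(edge_neq ie). Qed.

Lemma matched_rd z y : matched z y -> y != d. Proof. by case/and4P. Qed.

Lemma matched_ld z y : matched z y -> z != d.
Proof. by move/matched_lt; apply: contraNneq => ->. Qed.

Lemma matched_rb z y : matched z y -> y != b.
Proof. by move/matched_rt/neq_bt. Qed.

Lemma matched_lb z y : matched z y -> z != b.
Proof. by apply: contraTneq => ->; apply: matched_not_b. Qed.

(** Right ends of matched pairs are adjacent to [t], left ends are not. *)
Lemma matched_chain x y z : matched x y -> ~~ matched y z.
Proof. by move/matched_rt => yt; apply: contraL yt => /matched_lt. Qed.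

(** A path enters [t] from [d] or from another neighbour [y] of [t]. The vertex before [y] is not
    [s], as the borders are disjoint, so it is matched to [y]. *)
Lemma last_border A : connected e s t A ->
  exists2 y, y \in A & y = d \/ exists2 z, z \in A & matched z y.
Proof.
case/(connectedP _ _ st) => q [ep uq qA].
case: (lastP q) ep uq qA => [|q1 y] /=; first by rewrite (negbTE nst).
rewrite rcons_path last_rcons => /andP[p1 yt] uq qA.
have yA : y \in A by apply: qA; rewrite mem_rcons mem_head.
exists y => //; have [->|yd] := eqVneq y d; [by left | right].
case: (lastP q1) p1 uq qA {yA} => [|q2 z] /=.
  by rewrite andbT (negbTE (disj' yt)).
rewrite rcons_path last_rcons => /andP[_ zy] /andP[_].
rewrite !rcons_uniq => uq qA; exists z.
  by apply: qA; rewrite !(mem_rcons, inE) eqxx orbT.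
rewrite /matched zy yt yd !andbT /=.
apply: contraTneq uq => ->; by rewrite !(mem_rcons, inE) eqxx ?orbT.
Qed.

Definition mates : rel T := [rel x y | matched x y || matched y x].

Lemma mates_sym : symmetric mates. Proof. by move=> x y; rewrite /mates /= orbC. Qed.

Lemma mates_irr : irreflexive mates.
Proof. by move=> x; rewrite /mates /= /matched ie !andbF. Qed.

Lemma mates_fun x y z : mates x y -> mates x z -> y = z.
Proof.
case/orP=> xy /orP[] xz.
- exact: matched_r xy xz.
- by rewrite (negbTE (matched_chain _ xz)) in xy.
- by rewrite (negbTE (matched_chain _ xy)) in xz.
- exact: matched_l xy xz.
Qed.

(** Without [d] every path ends with a whole matched pair, which the pairing along [mates] denies to
    Short. *)
Lemma no_win_without_d A F : d \notin A :|: F ->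
  (forall x y, mates x y -> x \in A -> y \notin A :|: F) ->
  ~ win (connected e s t) A F.
Proof.
move=> dAF inv; apply: (pairing_cut mates_sym mates_irr mates_fun inv).
move=> B BAF Binv; apply/negP => /last_border[y yB [yd|[z zB zy]]].
  by rewrite (subsetP BAF) // -yd in dAF.
have /Binv/(_ zB) : mates z y by rewrite /mates /= zy.
by rewrite yB.
Qed.

(** A path through [y] would enter it from a vertex of [A] matched to [y]. *)
Lemma drop_useless (e' : rel T) y A : subrel e' e -> e y t -> y != d ->
  (forall z, matched z y -> z \notin A) ->
  connected e' s t (y |: A) -> connected e' s t A.
Proof.
move=> e'e yt yd nz /(connectedP _ _ st)[q [ep uq qA]].
suff yq : y \notin q.
  apply: path_connected ep _ => x xq; have /setU1P[xy|//] := qA _ xq.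
  by rewrite -xy xq in yq.
apply/negP => yq; case/splitPr: yq ep uq qA => q1 q2.
rewrite rcons_cat cat_path rcons_cons /= => /and3P[_ /e'e ey _] /andP[sq uq] qA.
have zt : last s q1 != t.
  apply: contraTneq uq => zt; rewrite -rcons_cons -rcons_cat rcons_uniq.
  rewrite negb_and negbK mem_cat -{1}zt.
  have := mem_last s q1; rewrite inE => /predU1P[ls|->//].
  by case/eqP: st; rewrite -ls.
have zy : matched (last s q1) y by rewrite /matched zt ey yt.
have := mem_last s q1; rewrite inE => /predU1P[ls|lq].
  by rewrite ls (negbTE (disj' yt)) in ey.
have : last s q1 \in y |: A by apply: qA; rewrite mem_cat lq.
by rewrite in_setU1 (negbTE (nz _ zy)) (negbTE (matched_neq zy)).
Qed.

Section Unmatched.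

Variable u : T.
Hypotheses (uC : u \in centre e s t) (uM : forall y, ~~ matched u y).
Local Notation e' := (del_edge e b u).

Lemma centre_s x : x \in centre e s t -> ~~ e s x.
Proof. by rewrite in_setD in_setU !in_set negb_or => /andP[/andP[]]. Qed.

Lemma centre_t x : x \in centre e s t -> ~~ e x t.
Proof. by rewrite in_setD in_setU !in_set negb_or [e t x]se => /andP[/andP[]]. Qed.

Lemma connected_without_b A F B : b \notin A :|: F -> B \subset F ->
  connected e s t (A :|: B) -> connected e' s t (A :|: B).
Proof.
move=> bAF BF; apply: connected_sub => // x y xS yS.
have nb z : z \in s |: (t |: (A :|: B)) -> z != b.
  apply: contraTneq => ->; move: bAF; rewrite !in_setU !in_set1 !negb_or.
  move=> /andP[-> bF]; have := bN; rewrite in_N => /andP[-> ->] /=.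
  by apply: contra bF; apply: (subsetP BF).
by apply: del_edge_l; apply: nb.
Qed.

Lemma win_without_b A F : b \notin A :|: F ->
  win (connected e s t) A F -> win (connected e' s t) A F.
Proof. by move=> bAF; apply: win_sub => // B BF; apply: connected_without_b BF. Qed.

(* Invariant of the simulation, in [e'], of a win in [e]: a claim of [b] by Short
   threatens [q], which is [d] or, once Cut has taken [d], the mate of a vertex
   adjacent to [b]; every other half-claimed matched pair is settled. *)
Record threat A F q : Prop := Threat {
  threat_free : F \subset N;
  threat_b : b \in F;
  threat_q : q \in F;
  threat_qb : q != b;
  threat_qt : e q t;
  threat_dis : forall x, x \in A -> x \notin F;
  threat_con : connected e' s t (b |: (q |: A));
  threat_d : d \notin A;
  threat_qd : q = d \/ d \notin F;
  threat_r : forall z y, matched z y -> y != q -> z \in A -> y \notin A :|: F;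
  threat_l : forall z y, matched z y -> y != q -> y \in A -> z \notin A :|: F;
  threat_mate : forall z, matched z q -> z \in A }.

Lemma e'_neq_u x y : x != u -> y != u -> e x y -> e' x y.
Proof. exact: del_edge_r. Qed.

Lemma neq_u_s x : e s x -> x != u.
Proof. by apply: contraTneq => ->; apply: centre_s. Qed.

Lemma neq_u_t x : e x t -> x != u.
Proof. by apply: contraTneq => ->; apply: centre_t. Qed.

Lemma uN : u \in N. Proof. by move: uC; rewrite in_setD => /andP[]. Qed.

Lemma su : s != u. Proof. by have := uN; rewrite in_N eq_sym => /andP[]. Qed.
Lemma tu : t != u.
Proof. by have := uN; rewrite in_N eq_sym [u == t]eq_sym => /andP[]. Qed.

Lemma matched_neq_u z y : matched z y -> z != u.
Proof. by apply: contraTneq => ->; apply: uM. Qed.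

Lemma step_mem A F m v x : x \in (m |: A) :|: (F :\ m :\ v) ->
  [\/ x = m, x \in A | x \in F /\ x != v].
Proof.
rewrite in_setU in_setU1 !in_setD1 => /orP[/predU1P[->|xA]|/and3P[xv _ xF]].
- exact: Or31.
- exact: Or32.
- exact: Or33.
Qed.

(** A round away from [b] and [q] preserves the threat when [v] is the only possible free mate of
    [m]: no half-claimed pair is left open. *)
Lemma threat_step A F q m v : threat A F q -> m \in F -> m != b -> m != q ->
  v != b -> v != q ->
  (forall y, matched m y -> y \in F -> y = v) ->
  (forall z, matched z m -> z \in F -> z = v) ->
  threat (m |: A) (F :\ m :\ v) q.
Proof.
move=> [FN bF qF qb qt dis con dA qd r l mate] mF mb mq vb vq my zm.
split=> //.
- by apply: subset_trans FN; apply/subsetP => x; rewrite !in_setD1 => /and3P[].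
- by rewrite !in_setD1 bF eq_sym vb eq_sym mb.
- by rewrite !in_setD1 qF eq_sym vq eq_sym mq.
- move=> x; rewrite !in_setD1 => /setU1P[->|/dis/negbTE->]; first by rewrite eqxx andbF.
  by rewrite !andbF.
- by apply: connectedS con; rewrite !setUS // subsetUr.
- rewrite in_setU1 negb_or dA andbT; apply/eqP => dm.
  by case: qd => [qd|]; [rewrite qd dm eqxx in mq | rewrite dm mF].
- by case: qd => [->|dF]; [left | right; rewrite !in_setD1 (negbTE dF) !andbF].
- move=> z y zy yq zA'; apply/negP => /step_mem yA'.
  have nzy := matched_neq zy; case/setU1P: zA' => [zm'|zA].
    subst z; case: yA' => [ym|yA|[yF yv]].
    + by rewrite ym eqxx in nzy.
    + by have := l _ _ zy yq yA; rewrite inE mF orbT.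
    + by rewrite (my _ zy yF) eqxx in yv.
  have := r _ _ zy yq zA; rewrite inE => /norP[nyA nyF].
  case: yA' => [ym|yA|[yF _]].
  + by rewrite ym mF in nyF.
  + by rewrite yA in nyA.
  + by rewrite yF in nyF.
- move=> z y zy yq yA'; apply/negP => /step_mem zA'.
  have nzy := matched_neq zy; case/setU1P: yA' => [ym'|yA].
    subst y; case: zA' => [zm'|zA|[zF zv]].
    + by rewrite zm' eqxx in nzy.
    + by have := r _ _ zy yq zA; rewrite inE mF orbT.
    + by rewrite (zm _ zy zF) eqxx in zv.
  have := l _ _ zy yq yA; rewrite inE => /norP[nzA nzF].
  case: zA' => [zm'|zA|[zF _]].
  + by rewrite zm' mF in nzF.
  + by rewrite zA in nzA.
  + by rewrite zF in nzF.
- by move=> z /mate zA; rewrite in_setU1 zA orbT.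
Qed.

(* Short has claimed [m], which [b] and [y] connect to the terminals; Cut has
   answered by taking [q], and [b] now threatens [y]. *)
Lemma threat_switch A F q m y : threat A F q -> m \in F -> m != b -> m != d ->
  e b m -> matched m y -> y \in F -> threat (m |: A) (F :\ m :\ q) y.
Proof.
move=> [FN bF qF qb qt dis con dA qd r l mate] mF mb md ebm my yF.
have mq : m != q by apply: contraTneq qt => <-; apply: matched_lt my.
have yq : y != q.
  by apply/eqP => yq; subst y; have /dis := mate _ my; rewrite mF.
have yt := matched_rt my.
split=> //.
- by apply: subset_trans FN; apply/subsetP => x; rewrite !in_setD1 => /and3P[].
- by rewrite !in_setD1 bF eq_sym qb eq_sym mb.
- by rewrite !in_setD1 yF yq eq_sym (matched_neq my).
- exact: matched_rb my.
- move=> x; rewrite !in_setD1 => /setU1P[->|/dis/negbTE->]; first by rewrite eqxx andbF.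
  by rewrite !andbF.
- apply: (@path_connected _ _ _ _ _ [:: b; m; y]); last first.
    by apply/allP; rewrite /= !inE !eqxx ?orbT.
  rewrite /= !e'_neq_u ?su ?tu ?(neq_u_s esb) ?(neq_u_t yt) ?(matched_neq_u my) //.
  by case/and4P: my.
- by rewrite in_setU1 negb_or eq_sym md.
- right; rewrite !in_setD1; case: qd => [->|/negbTE->]; by rewrite ?eqxx ?andbF.
- move=> z y1 zy y1y zA'; apply/negP => /step_mem yA'.
  have nzy := matched_neq zy; case/setU1P: zA' => [zm'|zA].
    by subst z; rewrite (matched_r zy my) eqxx in y1y.
  have [y1q|y1q] := eqVneq y1 q.
    subst y1; case: yA' => [qm|/dis|[_]]; rewrite ?eqxx ?qF //.
    by rewrite qm eqxx in mq.
  have := r _ _ zy y1q zA; rewrite inE => /norP[nyA nyF].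
  case: yA' => [ym|yA|[y1F _]].
  + by rewrite ym mF in nyF.
  + by rewrite yA in nyA.
  + by rewrite y1F in nyF.
- move=> z y1 zy y1y yA'; apply/negP => /step_mem zA'.
  case/setU1P: yA' => [ym'|yA].
    by subst y1; have := matched_chain y zy; rewrite my.
  have y1q : y1 != q by apply: contraTneq yA => ->; apply: contraL qF => /dis.
  have := l _ _ zy y1q yA; rewrite inE => /norP[nzA nzF].
  case: zA' => [zm'|zA|[zF _]].
  + by rewrite zm' mF in nzF.
  + by rewrite zA in nzA.
  + by rewrite zF in nzF.
- by move=> z zy; rewrite (matched_l zy my) setU11.
Qed.

(* Once Cut has both removed [q] and answered so that no matched pair is half
   claimed, the pairing strategy defeats Short. *)
Lemma threat_parried A F q m : threat A F q -> m \in F -> m != q ->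
  ~~ e m t -> (forall y, matched m y -> y \in F -> y = q) ->
  ~ win (connected e s t) (m |: A) (F :\ m :\ q).
Proof.
move=> [FN bF qF qb qt dis con dA qd r l mate] mF mq mt my.
have md : m != d by apply: contraNneq mt => ->.
apply: no_win_without_d => [|x y xy xA'].
  apply/negP => /step_mem[dm|dA'|[dF dq]].
  + by rewrite dm eqxx in md.
  + by rewrite dA' in dA.
  + by case: qd => [qd|/negP//]; rewrite qd eqxx in dq.
apply/negP => /step_mem yA'; case/setU1P: xA' => [xm|xA].
  subst x; case/orP: xy => [xy|/matched_rt]; last by rewrite (negbTE mt).
  have nxy := matched_neq xy; case: yA' => [ym|yA|[yF yq]].
  + by rewrite ym eqxx in nxy.
  + have yq : y != q by apply: contraTneq yA => ->; apply: contraL qF => /dis.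
    by have := l _ _ xy yq yA; rewrite inE mF orbT.
  + by rewrite (my _ xy yF) eqxx in yq.
have xq : x != q by apply: contraTneq xA => ->; apply: contraL qF => /dis.
case/orP: xy => xy.
  have [yq|yq] := eqVneq y q.
    subst y; case: yA' => [qm|/dis|[_]]; rewrite ?eqxx ?qF //.
    by rewrite qm eqxx in mq.
  have := r _ _ xy yq xA; rewrite inE => /norP[nyA nyF].
  case: yA' => [ym|yA|[yF _]].
  + by rewrite ym mF in nyF.
  + by rewrite yA in nyA.
  + by rewrite yF in nyF.
have := l _ _ xy xq xA; rewrite inE => /norP[nyA nyF].
case: yA' => [ym|yA|[yF _]].
+ by rewrite ym mF in nyF.
+ by rewrite yA in nyA.
+ by rewrite yF in nyF.
Qed.

(** Induction on the win in [e]. In [e'] Short copies its moves, skips the useless ones, and claims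
    [b] only to win at once or to make two threats. *)
Lemma threat_win A F q : threat A F q ->
  win (connected e s t) A F -> win (connected e' s t) A F.
Proof.
move=> K w; elim: w q K => {A F} A F.
  move=> gA q K; left; rewrite -[A]setU0; apply: (connected_without_b (F := set0)).
  - by rewrite setU0; apply: contraL (threat_b K) => /(threat_dis K).
  - exact: sub0set.
  - by rewrite setU0.
move=> m mF wm IH q K; have [FN bF qF qb qt dis con dA qd r l mate] := K.
have bA : b \notin A by apply: contraL bF => /dis.
have mN := subsetP FN _ mF.
(* The move [b] cannot win in [e]: Cut's answer [q] defeats it. *)
have [mb|mb] := eqVneq m b.
  subst m; case: (threat_parried K mF _ _ _ (wm q)); rewrite 1?eq_sym ?disj //.
  by move=> y by'; rewrite (negbTE (matched_not_b y)) in by'.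
(* After [q], Short only needs [b]; if Cut takes [b], the two graphs no longer differ. *)
have [mq|mq] := eqVneq m q.
  subst m; apply: (WinMove qF) => v; have [->|vb] := eqVneq v b.
    apply: win_without_b (wm b); apply/negP => /step_mem[/esym/eqP|/idPn|[_]].
    - by rewrite (negbTE qb).
    - by rewrite bA.
    - by rewrite eqxx.
  apply: (@WinMove _ _ _ _ b) => [|v']; last by left.
  by rewrite !in_setD1 bF eq_sym vb eq_sym qb.
have mb_win : forall v, v = b -> win (connected e' s t) (m |: A) (F :\ m :\ v).
  move=> v ->; apply: win_without_b (wm b).
  apply/negP => /step_mem[/esym/eqP|/idPn|[_]].
  - by rewrite (negbTE mb).
  - by rewrite bA.
  - by rewrite eqxx.
(* Let Cut answer a move [m] next to [t] by its mate, or pass ([v] equal to [m]) if it has none.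
   Then [m] is useless, so what wins after this exchange also wins without it. *)
have [mt|mt] := boolP (e m t).
  have md : m != d.
    apply/eqP => dm; case: qd => [qd|]; last by rewrite -dm mF.
    by rewrite dm -qd eqxx in mq.
  have [v [vb vq vP vA]] : exists v, [/\ v != b, v != q,
      forall z, matched z m -> z = v & v \notin A].
    have [/existsP[z zm]|nz] := boolP [exists z, matched z m].
      exists z; split.
      - exact: matched_lb zm.
      - by apply: contraTneq qt => <-; apply: matched_lt zm.
      - by move=> z' z'm; apply: matched_l z'm zm.
      - by apply/negP => /(r _ _ zm mq); rewrite inE mF orbT.
    exists m; split=> //; last by apply: contraL mF => /dis.
    by move=> z zm; case/negP: nz; apply/existsP; exists z.
  have K' : threat (m |: A) (F :\ m :\ v) q.
    apply: threat_step => // [y my|z /vP//].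
    by have := matched_lt my; rewrite mt.
  apply: win_sub (IH v q K').
    by apply/subsetP => x; rewrite !in_setD1 => /and3P[].
  move=> B BF; rewrite -setUA; apply: drop_useless => //.
    by move=> x y; rewrite del_edgeE => /andP[].
  move=> z /vP ->; rewrite in_setU (negbTE vA) /=.
  by apply/negP => /(subsetP BF); rewrite !in_setD1 eqxx.
have md : m != d by apply: contraNneq mt => ->.
have mmate y : matched m y -> y != q.
  by apply: contraTneq => ->; apply/negP => /mate/dis; rewrite mF.
have nolm z : ~~ matched z m by apply: contra mt => /matched_rt.
(* With a free mate [y], the move [m] prepares a path through [y], being joined to [s] directly or
   through [b]. *)
have [/exists_inP[y yF my]|nomate] := boolP [exists y in F, matched m y].
  have yq := mmate _ my; have yb := matched_rb my; have yt := matched_rt my.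
  have answer_y : win (connected e' s t) (m |: A) (F :\ m :\ y).
    apply: (IH y q); apply: threat_step => // [y' my' _|z zm].
      exact: matched_r my' my.
    by rewrite (negbTE (nolm z)) in zm.
  have mu := matched_neq_u my; have yu := neq_u_t yt.
  have emy : e m y by case/and4P: my.
  have claim_y v v' : v != y -> y \in F :\ m :\ v.
    by move=> vy; rewrite !in_setD1 yF eq_sym vy eq_sym (matched_neq my).
  have [sm|sm] := boolP (e s m).
    apply: (WinMove mF) => v; have [->//|vy] := eqVneq v y.
    apply: (WinMove (claim_y v v vy)) => v'; left.
    apply: (@path_connected _ _ _ _ _ [:: m; y]).
      by rewrite /= !e'_neq_u ?su ?tu.
    by apply/allP; rewrite /= !inE !eqxx ?orbT.
  have ebm : e b m by apply/bC/centreP.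
  apply: (WinMove mF) => v; have [/mb_win//|vb] := eqVneq v b.
  have [->//|vy] := eqVneq v y.
  have [->|vq] := eqVneq v q.
    exact: IH (threat_switch K mF mb md ebm my yF).
  (* Claiming [b] now threatens both [q] and [y]. *)
  apply: (@WinMove _ _ _ _ b) => [|v'].
    by rewrite !in_setD1 bF eq_sym vb eq_sym mb.
  have [->|v'q] := eqVneq v' q.
    apply: (@WinMove _ _ _ _ y) => [|v2]; last first.
      left; apply: (@path_connected _ _ _ _ _ [:: b; m; y]).
        by rewrite /= !e'_neq_u ?su ?tu // (neq_u_s esb).
      by apply/allP; rewrite /= !inE !eqxx ?orbT.
    by rewrite in_setD1 yq in_setD1 yb claim_y.
  apply: (@WinMove _ _ _ _ q) => [|v2].
    rewrite !in_setD1 qF eq_sym v'q qb eq_sym vq; by rewrite eq_sym mq.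
  left; apply: connectedS con; rewrite setUCA !setUS //; exact: subsetUr.
have nomate' y : matched m y -> y \in F -> False.
  by move=> my yF; case/negP: nomate; apply/exists_inP; exists y.
apply: (WinMove mF) => v; have [/mb_win//|vb] := eqVneq v b.
(* Since [m] has no free mate, Cut's taking [q] would defeat Short already in [e]. *)
have [vq|vq] := eqVneq v q.
  subst v; case: (threat_parried K mF mq mt _ (wm q)) => y my yF.
  by case: (nomate' _ my yF).
apply: (IH v q); apply: threat_step => // [y my yF|z zm].
  by case: (nomate' _ my yF).
by rewrite (negbTE (nolm z)) in zm.
Qed.

(** At the start [b] threatens [d], without the edge [b u]; so Short wins when that edge is deleted,
    against minimality. *)
Lemma unmatched_edge_superfluous : False.
Proof.
apply: (em.2 b u); first exact: bC.
apply: (threat_win (q := d)) em.1; split=> //.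
- exact: bN.
- exact: dN.
- by rewrite eq_sym bd.
- by move=> x; rewrite inE.
- apply: (@path_connected _ _ _ _ _ [:: b; d]).
    by rewrite /= !e'_neq_u ?su ?tu ?(neq_u_s esb) ?(neq_u_t edt).
  by apply/allP; rewrite /= !inE !eqxx ?orbT.
- by rewrite inE.
- by left.
- by move=> z y _ _; rewrite inE.
- by move=> z y _ _; rewrite inE.
- by move=> z /matched_rd; rewrite eqxx.
Qed.

End Unmatched.

Lemma neq_sc x c : e s x -> c \in centre e s t -> x != c.
Proof. by move=> sx; apply: contraTneq => <-; apply: contraL sx => /centre_s. Qed.

Lemma neq_ct c y : c \in centre e s t -> e y t -> c != y.
Proof. by move=> cC; apply: contraTneq => <-; apply: centre_t. Qed.

Lemma neq_st x y : e s x -> e y t -> x != y.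
Proof. by move=> sx; apply: contraTneq => <-; apply: disj. Qed.

(** On the centre the default [c] is never taken: every vertex there is matched. *)
Definition mate c := odflt c [pick y | matched c y].

Lemma mateP c : c \in centre e s t -> matched c (mate c).
Proof.
move=> cC; rewrite /mate; case: pickP => //= nc.
by case: (unmatched_edge_superfluous cC) => y; rewrite nc.
Qed.

Lemma mate_t c : c \in centre e s t -> e (mate c) t.
Proof. by move/mateP/matched_rt. Qed.

(** * Winning without the edge [b d] by walking through the centre *)

Section Bridge.

Local Notation e2 := (del_edge e b d).

Lemma connected_extend A x y : connect (induced e2 s t A) s x -> x \in A ->
  e2 x y -> e2 y t -> connected e2 s t (y |: A).
Proof.
move=> cx xA xy yt; apply: (@connect_trans _ _ x).
  apply: connect_sub cx => u v uv; apply: connect1.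
  by apply: induced_sub uv => //; apply: subsetUr.
apply: (@connect_trans _ _ y); apply: connect1; apply/and3P; split=> //.
- by rewrite !in_setU xA !orbT.
- by rewrite !in_setU !in_set1 eqxx !orbT.
- by rewrite !in_setU !in_set1 eqxx !orbT.
- by rewrite !in_setU !in_set1 eqxx !orbT.
Qed.

Lemma connect_extend A x y : connect (induced e2 s t A) s x -> x \in A ->
  e2 x y -> connect (induced e2 s t (y |: A)) s y.
Proof.
move=> cx xA xy; apply: (@connect_trans _ _ x).
  apply: connect_sub cx => u v uv; apply: connect1.
  by apply: induced_sub uv => //; apply: subsetUr.
apply: connect1; apply/and3P; split=> //.
- by rewrite !in_setU xA !orbT.
- by rewrite !in_setU !in_set1 eqxx !orbT.
Qed.

Lemma e2_neq_b x y : x != b -> y != b -> e x y -> e2 x y.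
Proof. exact: del_edge_l. Qed.

Lemma e2_neq_d x y : x != d -> y != d -> e x y -> e2 x y.
Proof. exact: del_edge_r. Qed.

Lemma centre_neq_b c : c \in centre e s t -> c != b.
Proof. by rewrite eq_sym; apply: neq_sc. Qed.

Lemma tb : t != b.
Proof. by have := bN; rewrite in_N [b == t]eq_sym => /andP[]. Qed.

(* What Short needs to be free in order to advance from [c] along [p] to [d]. *)
Definition chain F c p :=
  [/\ d \in F, {subset p <= F} & {in c :: p, forall x, mate x \in F}].

Lemma chain_del F c p x : e s x -> {subset c :: p <= centre e s t} ->
  chain F c p -> chain (F :\ x) c p.
Proof.
move=> sx cp [dF pF mF]; split=> [|y yp|y yp]; rewrite in_setD1.
- by rewrite dF eq_sym neq_st.
- by rewrite pF // eq_sym neq_sc // cp // inE yp orbT.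
- by rewrite mF // eq_sym neq_st // mate_t // cp.
Qed.

Lemma chain_step F c c2 p : {subset [:: c, c2 & p] <= centre e s t} ->
  uniq [:: c, c2 & p] -> chain F c (c2 :: p) -> chain (F :\ mate c :\ c2) c2 p.
Proof.
move=> cp /= /andP[cn /andP[c2n _]] [dF pF mF].
have cC : c \in centre e s t by apply: cp; rewrite mem_head.
have c2C : c2 \in centre e s t by apply: cp; rewrite !inE eqxx orbT.
split=> [|y yp|y yp]; rewrite !in_setD1.
- by rewrite dF eq_sym neq_ct // eq_sym (matched_rd (mateP cC)).
- have yC : y \in centre e s t by apply: cp; rewrite !inE yp !orbT.
  rewrite pF ?inE ?yp ?orbT // (neq_ct yC (mate_t cC)) !andbT.
  by apply: contraTneq yp => ->.
have yC : y \in centre e s t by apply: cp; rewrite inE yp orbT.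
rewrite mF; last by rewrite inE yp orbT.
rewrite eq_sym (neq_ct c2C (mate_t yC)) andbT /=.
apply: contraNneq cn => yc; have yM := mateP yC; rewrite yc in yM.
by rewrite (matched_l (mateP cC) yM).
Qed.

(** Here [v] is Cut's latest answer. As [c] is joined to [s], Short wins with [mate c] unless [v] is
    that vertex; then he advances along [p] or, at its end, takes [d]. *)
Lemma chain_win p c A F v : c \in A -> connect (induced e2 s t A) s c ->
  path e c p -> e (last c p) d -> {subset c :: p <= centre e s t} ->
  uniq (c :: p) -> chain F c p -> win (connected e2 s t) A (F :\ v).
Proof.
elim: p c A F v => [|c2 p IH] c A F v cA sc pp ld pC up ch;
  have [dF pF mF] := ch; have cC := pC c (mem_head _ _);
  have cm := mateP cC; have [_ ecm mt md] := and4P cm; have cb := centre_neq_b cC;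
  have mb := neq_bt mt.
- have [->|vm] := eqVneq v (mate c).
    apply: (@WinMove _ _ _ _ d) => [|v']; first by rewrite in_setD1 eq_sym md.
    by left; apply: connected_extend sc cA _ _; apply: e2_neq_b; rewrite ?tb // eq_sym bd.
  apply: (@WinMove _ _ _ _ (mate c)) => [|v'].
    by rewrite in_setD1 eq_sym vm mF // mem_head.
  by left; apply: connected_extend sc cA _ _; apply: e2_neq_b; rewrite ?tb.
have [->|vm] := eqVneq v (mate c); last first.
  apply: (@WinMove _ _ _ _ (mate c)) => [|v'].
    by rewrite in_setD1 eq_sym vm mF // mem_head.
  by left; apply: connected_extend sc cA _ _; apply: e2_neq_b; rewrite ?tb.
have c2C : c2 \in centre e s t by apply: pC; rewrite !inE eqxx orbT.
move: pp => /= /andP[cc2 pp].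
apply: (@WinMove _ _ _ _ c2) => [|v'].
  by rewrite in_setD1 (neq_ct c2C mt) pF // mem_head.
apply: (IH c2) => //.
- exact: setU11.
- by apply: connect_extend sc cA _; apply: e2_neq_b; rewrite ?centre_neq_b.
- by move=> x xp; apply: pC; rewrite inE xp orbT.
- by case/andP: up.
- exact: chain_step.
Qed.

Variable a : T.
Hypotheses (ab : a != b) (esa : e s a).

Definition doubly_linked A c :=
  forall x, x \in [:: a; b] -> connect (induced e2 s t (x |: A)) s c.

Lemma link_s x : x \in [:: a; b] -> e s x.
Proof. by rewrite !inE => /orP[] /eqP->. Qed.

Lemma other_link v : exists2 x, x \in [:: a; b] & x != v.
Proof.
have [->|va] := eqVneq v a; first by exists b; rewrite ?inE ?eqxx ?orbT // eq_sym.
by exists a; rewrite ?inE ?eqxx // eq_sym.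
Qed.

(** Once Short has claimed [y], Cut can take only one of [a] and [b]; the other completes the
    path. *)
Lemma double_link_win A F c y : c \in A -> doubly_linked A c ->
  {subset [:: a; b] <= F} -> c \in centre e s t -> e c y -> e y t -> y \in F ->
  win (connected e2 s t) A F.
Proof.
move=> cA sc abF cC cy yt yF; apply: (WinMove yF) => v.
have [x xab xv] := other_link v.
apply: (@WinMove _ _ _ _ x) => [|v'].
  by rewrite !in_setD1 xv abF // (neq_st (link_s xab)).
left; rewrite setUCA; apply: connected_extend (sc x xab) _ _ _.
- by rewrite in_setU1 cA orbT.
- exact: e2_neq_b (centre_neq_b cC) (neq_bt yt) cy.
- exact: e2_neq_b (neq_bt yt) tb yt.
Qed.

(* As long as both [a] and [b] are free, either of them completes the connection
   of [c] to [s], so Cut's taking one is answered by the other. *)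
Lemma double_chain_win p c A F v : c \in A -> doubly_linked A c ->
  {subset [:: a; b] <= F} -> path e c p -> e (last c p) d ->
  {subset c :: p <= centre e s t} -> uniq (c :: p) -> chain F c p ->
  win (connected e2 s t) A (F :\ v).
Proof.
elim: p c A F v => [|c2 p IH] c A F v cA sc abF pp ld pC up ch;
  have [dF pF mF] := ch; have cC := pC c (mem_head _ _);
  have cm := mateP cC; have [_ ecm mt md] := and4P cm;
  (have [vab|vab] := boolP (v \in [:: a; b]);
    [ have [x xab xv] := other_link v;
      apply: (@WinMove _ _ _ _ x) => [|v'];
      [ by rewrite in_setD1 xv abF
      | apply: (chain_win _ _ (sc x xab) pp ld pC up);
        [ by rewrite in_setU1 cA orbT
        | by do 2!(apply: chain_del; rewrite ?link_s //) ]] |]);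
  (have abF' : {subset [:: a; b] <= F :\ v} by
    (move=> x xab; rewrite in_setD1 abF // andbT; apply: contraNneq vab => <-)).
- have [vm|vm] := eqVneq v (mate c).
    apply: (double_link_win cA sc abF' cC ld edt).
    by rewrite in_setD1 vm eq_sym md.
  apply: (double_link_win cA sc abF' cC ecm mt).
  by rewrite in_setD1 eq_sym vm mF // mem_head.
have [vm|vm] := eqVneq v (mate c); last first.
  apply: (double_link_win cA sc abF' cC ecm mt).
  by rewrite in_setD1 eq_sym vm mF // mem_head.
have c2C : c2 \in centre e s t by apply: pC; rewrite !inE eqxx orbT.
move: pp => /= /andP[cc2 pp]; rewrite vm.
apply: (@WinMove _ _ _ _ c2) => [|v'].
  by rewrite in_setD1 (neq_ct c2C mt) pF // mem_head.
apply: (IH c2) => //.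
- exact: setU11.
- move=> x xab; rewrite setUCA; apply: connect_extend (sc x xab) _ _.
    by rewrite in_setU1 cA orbT.
  by apply: e2_neq_b; rewrite ?centre_neq_b.
- move=> x xab; rewrite !in_setD1 neq_sc ?link_s //=.
  by rewrite (neq_st (link_s xab) mt) abF.
- by move=> x xp; apply: pC; rewrite inE xp orbT.
- by case/andP: up.
- exact: chain_step.
Qed.

(** Short opens with [c], a common neighbour of [a] and [b], and walks along [p]. *)
Lemma bridge_win c p : e a c -> path e c p -> e (last c p) d ->
  {subset c :: p <= centre e s t} -> uniq (c :: p) -> wins_first e2 s t.
Proof.
move=> ac pp ld pC up; have cC := pC c (mem_head _ _).
have CN x : x \in centre e s t -> x \in N by rewrite in_setD => /andP[].
apply: (@WinMove _ _ _ _ c) => [|v]; first exact: CN.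
apply: (double_chain_win v _ _ _ pp ld pC up); first exact: setU11.
- have ead x : x \in [:: a; b] -> e x c.
    by rewrite !inE => /orP[] /eqP-> //; apply: bC.
  move=> x xab; have sx := link_s xab.
  apply: (@connect_trans _ _ x); apply: connect1; apply/and3P; split.
  + apply: e2_neq_d; rewrite ?(neq_st sx edt) //.
    by have := dN; rewrite in_N eq_sym => /andP[].
  + by rewrite !in_setU !in_set1 eqxx.
  + by rewrite !in_setU !in_set1 eqxx !orbT.
  + exact: e2_neq_d (neq_st sx edt) (neq_ct cC edt) (ead x xab).
  + by rewrite !in_setU !in_set1 eqxx !orbT.
  + by rewrite !in_setU !in_set1 eqxx !orbT.
- move=> x xab; have sx := link_s xab.
  by rewrite in_setD1 neq_sc // borderN.
split=> [|x xp|x xp]; rewrite in_setD1.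
- by rewrite dN eq_sym (neq_ct cC edt).
- have xC : x \in centre e s t by apply: pC; rewrite inE xp orbT.
  rewrite CN // andbT; move: up => /= /andP[cn _].
  by apply: contraNneq cn => <-.
have xt := mate_t (pC x xp).
by rewrite eq_sym (neq_ct cC xt) borderN'.
Qed.

End Bridge.

(** * Cut's pairing when no such walk reaches [d] *)

Definition bridged x := exists a c,
  [/\ a != b, e s a, c \in centre e s t, e a c &
    connect [rel x y | e x y && (y \in centre e s t)] c x].

Lemma not_bridged_to_d x : bridged x -> ~~ e x d.
Proof.
move=> [a [c [ab sa cC ac]]] /connectP[p pp ->]; apply/negP.
case: (shortenP pp) => {pp} q qp qu _ ld; apply: (em.2 b d ebd).
apply: (bridge_win ab sa ac _ ld _ qu).
  by apply: sub_path qp => u v /andP[].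
move=> x0; rewrite inE => /predU1P[->//|].
elim: q c qp {cC ac qu ld} => //= y q IH c /andP[/andP[_ yC] yq].
by rewrite inE => /predU1P[->//|]; apply: IH yq.
Qed.

Definition near_s x := e s x && (x != b) \/ x \in centre e s t /\ bridged x.

(** An invariant of paths from [s] that avoid [b]. The universal last clause serves when a path
    leaves a vertex next to [t] for the centre, which it can do only towards a matched vertex. *)
Definition short_side x :=
  [\/ x = s, near_s x | [/\ e x t, x != d & forall z, matched z x -> near_s z]].

Lemma short_side_d x : short_side x -> ~~ e x d.
Proof.
case=> [->|[/andP[sx xb]|[_ /not_bridged_to_d//]]|[xt _ _]].
- exact: disj'.
- by apply: contra xb => xd; apply/eqP; apply: one_s edt xd ebd sx esb.
- exact: noT.
Qed.

Lemma short_side_step x y : short_side x -> e x y -> y \in N -> y != b -> y != d ->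
  short_side y.
Proof.
move=> xs xy yN yb yd.
have [sy|sy] := boolP (e s y); first by apply: Or32; left; rewrite sy.
have yt' : y != t by move: yN; rewrite in_N => /andP[].
have [yt|yt] := boolP (e y t).
  case: xs => [xs|xn|[xt _ _]].
  - by rewrite -xs xy in sy.
  - apply: Or33; split=> // z zy; suff <- : x = z by [].
    apply: matched_l zy; rewrite /matched xy yt yd !andbT.
    case: xn => [/andP[/borderN]|[]]; first by rewrite in_N => /andP[].
    by rewrite in_setD in_N => /and3P[].
  - by have := noT xt yt; rewrite xy.
have yC := centreP yN sy yt.
case: xs => [xs|[/andP[sx xb]|[xC [a [c [ab sa cC ac cx]]]]]|[xt xd xm]].
- by rewrite -xs xy in sy.
- by apply: Or32; right; split=> //; exists x, y; rewrite connect0.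
- apply: Or32; right; split=> //; exists a, c; split=> //.
  by apply: connect_trans cx _; apply: connect1; rewrite /= xy yC.
by apply: Or32; apply: xm; rewrite /matched yt' se xy xt.
Qed.

Lemma short_side_path q x : short_side x -> path e x q -> {subset q <= N} ->
  b \notin q -> d \notin q.
Proof.
elim: q x => //= y q IH x xs /andP[xy yq] qN.
rewrite !inE !negb_or => /andP[by' bq].
have yd : d != y by apply: contraTneq xy => <-; apply: short_side_d.
rewrite yd; apply: (IH y) => //; last by move=> z zq; apply: qN; rewrite inE zq orbT.
by apply: (short_side_step xs xy); rewrite 1?eq_sym // qN // mem_head.
Qed.

Definition mates_bd : rel T :=
  [rel x y | [|| mates x y, (x == b) && (y == d) | (x == d) && (y == b)]].

Lemma mates_neq_bd x y : mates x y -> (x != b) && (x != d).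
Proof.
by case/orP=> xy; rewrite ?(matched_lb xy) ?(matched_ld xy) ?(matched_rb xy) ?(matched_rd xy).
Qed.

(** Cut pairs [b] with [d] and follows the matching elsewhere. A path of Short must then end with
    [d] and so avoid [b], but no path avoiding [b] reaches [d]. *)
Lemma full_border_vertex_absurd : False.
Proof.
have Nb : (d == b) = false by rewrite eq_sym (negbTE bd).
apply: (pairing_cut (pr := mates_bd)) em.1.
- move=> x y; rewrite /mates_bd /= mates_sym; congr (_ || _).
  by rewrite orbC ![_ && (y == _)]andbC.
- move=> x; rewrite /mates_bd /= mates_irr /=.
  by case: (eqVneq x b) => [->|]; rewrite ?(negbTE bd) ?andbF.
- move=> x y z /or3P[xy|/andP[/eqP-> /eqP->]|/andP[/eqP-> /eqP->]].
  + have /andP[/negbTE xb /negbTE xd] := mates_neq_bd xy.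
    by rewrite /mates_bd /= xb xd !orbF; apply: mates_fun.
  + case/or3P => [/mates_neq_bd|/andP[_ /eqP]|]; rewrite ?eqxx //.
    by rewrite (negbTE bd).
  + case/or3P => [/mates_neq_bd|/andP[]|/andP[_ /eqP]]; rewrite ?eqxx ?andbF //.
    by rewrite Nb.
- by move=> x y _; rewrite inE.
move=> B; rewrite set0U => BN inv; apply/negP => /(connectedP _ _ st)[q [ep _ qB]].
have qN : {subset q <= N} by move=> x /qB; apply: (subsetP BN).
have : connected e s t [set x in q] by apply: path_connected ep _ => x; rewrite inE.
case/last_border => y; rewrite inE => yq [yd|[z]]; last first.
  rewrite inE => zq zy; have /inv/(_ (qB _ zq)) : mates_bd z y.
    by rewrite /mates_bd /mates /= zy.
  by rewrite (qB _ yq).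
subst y; have bB : b \notin B.
  by apply: (inv d b) (qB _ yq); rewrite /mates_bd /= !eqxx !orbT.
suff : d \notin q by rewrite yq.
apply: (@short_side_path q s) => //; first exact: Or31.
  by move: ep; rewrite rcons_path => /andP[].
by apply: contra bB => /qB.
Qed.

End FullBorderVertex.

(** * The degree bound *)

Section Degree.

Variables (T : finType) (e : rel T) (s t : T).
Hypotheses (se : symmetric e) (ie : irreflexive e) (st : s != t).
Local Notation N := (nonterminals s t).

Lemma degree_bound_sym b : degree_bound e t s b -> degree_bound e s t b.
Proof.
rewrite /degree_bound /weight /centre /nonterminals.
by rewrite [[set t; s]]setUC [nbhd e t :|: _]setUC.
Qed.

Lemma degree_bound_s b : minimal_win e s t -> b \in N -> e s b ->
  degree_bound e s t b.
Proof.
move=> em bN sb.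
have nst : ~~ e s t by apply: (terminals_not_adjacent se em bN); rewrite sb.
have nts : ~~ e t s by rewrite se.
have em' := minimal_win_sym se em.
have bN' : b \in nonterminals t s by rewrite in_N andbC -in_N.
(* Degenerate links come first; excluding them yields [disj], [one_t] and [one_s]. *)
have [/existsP[x /andP[sx xt]]|nx] := boolP [exists x, e s x && e x t].
  exact: (common_border_bound se ie em bN sx xt).
have disj x : e s x -> ~~ e x t.
  by move=> sx; apply: contra nx => xt; apply/existsP; exists x; rewrite sx.
have disj' x : e t x -> ~~ e x s.
  by rewrite se [e x s]se => xt; apply: contraL xt; apply: disj.
have [/existsP[x /existsP[y1 /existsP[y2]]]|ny] := boolP [exists x, exists y1,
    exists y2, [&& y1 != y2, e s x, e x y1, e x y2, e y1 t & e y2 t]].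
  move=> /and5P[y12 sx xy1 xy2 /andP[y1t y2t]].
  exact: (two_neighbours_bound se ie em nst disj bN y12 sx xy1 xy2 y1t y2t).
have [/existsP[y /existsP[x1 /existsP[x2]]]|nx'] := boolP [exists y, exists x1,
    exists x2, [&& x1 != x2, e t y, e y x1, e y x2, e x1 s & e x2 s]].
  move=> /and5P[x12 ty yx1 yx2 /andP[x1s x2s]]; apply: degree_bound_sym.
  exact: (two_neighbours_bound se ie em' nts disj' bN' x12 ty yx1 yx2 x1s x2s).
have one_t x y1 y2 : e s x -> e x y1 -> e x y2 -> e y1 t -> e y2 t -> y1 = y2.
  move=> sx xy1 xy2 y1t y2t; apply: contraNeq ny => y12; apply/existsP; exists x.
  by apply/existsP; exists y1; apply/existsP; exists y2; apply/and5P; rewrite y1t.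
have one_s y x1 x2 : e y t -> e x1 y -> e x2 y -> e s x1 -> e s x2 -> x1 = x2.
  move=> yt x1y x2y sx1 sx2; apply: contraNeq nx' => x12; apply/existsP; exists y.
  apply/existsP; exists x1; apply/existsP; exists x2; apply/and5P.
  by split; rewrite // 1?se // sx1 se.
have noS x y : e s x -> e s y -> ~~ e x y := no_border_edge ie em nst.
have noT x y : e x t -> e y t -> ~~ e x y.
  by rewrite ![e _ t]se; apply: (no_border_edge ie em').
set C := centre e s t.
have nbC y : e b y -> [\/ y = s, y \in C | e y t].
  move=> eby; have [->|ys] := eqVneq y s; first exact: Or31.
  have [yt|yt] := boolP (e y t); first exact: Or33.
  have yt' : y != t by apply: contraTneq eby => ->; apply: disj.
  apply: Or32; rewrite in_setD in_N ys yt' andbT in_setU !in_set negb_or [e t y]se yt.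
  by rewrite !andbT; apply: contraL eby => /(noS _ _ sb).
(* With no neighbour in the opposite border, only [s] and the centre count, which gives both
   bounds. *)
have [/existsP[d /andP[bd dt]]|nd] := boolP [exists d, e b d && e d t]; last first.
  suff le : degree e b <= #|C| + 1.
    by split=> _ //; apply: leq_trans le _; rewrite leq_add2l.
  have : nbhd e b \subset s |: C.
    apply/subsetP => y; rewrite in_set => eby; case: (nbC _ eby) => [->|yC|yt].
    - exact: setU11.
    - by rewrite in_setU yC orbT.
    - by case/negP: nd; apply/existsP; exists y; rewrite eby.
  move=> /subset_leq_card/leq_trans; apply; apply: leq_trans (leq_card_setU _ _) _.
  by rewrite cards1 addnC.
(* The summand 2 counts [s] and [d], the only neighbours of [b] outside the centre. *)
have deg_le (D : {set T}) : {in C, forall y, e b y -> y \in D} ->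
    degree e b <= #|D| + 2.
  move=> H; have : nbhd e b \subset D :|: [set s; d].
    apply/subsetP => y; rewrite in_set in_setU in_set2 => eby.
    case: (nbC _ eby) => [->|yC|yt].
    - by rewrite eqxx orbT.
    - by rewrite H.
    - by rewrite (one_t _ _ _ sb eby bd yt dt) eqxx !orbT.
  move=> /subset_leq_card/leq_trans; apply; apply: leq_trans (leq_card_setU _ _) _.
  by rewrite leq_add2l cards2; case: eqP.
split=> [_|w5]; first exact: deg_le.
(* A centre vertex not adjacent to [b] lowers the count by one; there must be one, by the preceding
   section. *)
have [/exists_inP[c cC nbc]|/exists_inPn nc] := boolP [exists c in C, ~~ e b c].
  apply: leq_trans (deg_le (C :\ c) _) _.
    move=> y yC eby; rewrite in_setD1 yC andbT.
    by apply: contraTneq eby => ->.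
  by rewrite [in X in _ <= X](cardsD1 c C) cC add1n addn1 addn2.
have bC c : c \in C -> e b c by move/nc; rewrite negbK.
by case: (full_border_vertex_absurd se ie st em w5 nst disj one_t one_s noT sb bd dt bC).
Qed.

End Degree.

Theorem theorem2 (T : finType) (e : rel T) (s t : T)
    (Ge : simple_graph e) (st : s != t)
    (mw : minimal_weak_link e s t)
    (b : T) (hb : b \in border_vertices e s t) :
  (3 < weight s t -> degree e b <= #|centre e s t| + 2) /\
  (5 < weight s t -> degree e b <= #|centre e s t| + 1).
Proof.
have [se ie] := Ge; have em := minimal_weak_link_win st mw.
move: hb; rewrite in_setI => /andP[hb bN].
move: hb; rewrite in_setU !in_set => /orP[sb|tb].
  exact: (degree_bound_s se ie st em bN sb).
apply: degree_bound_sym; apply: (degree_bound_s se ie) => //.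
- by rewrite eq_sym.
- exact: minimal_win_sym.
- by move: bN; rewrite /nonterminals setUC.
Qed.
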